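(* Let $(A,q)$ be a finite metric abelian group. For every $Q,P\in\mathcal Q(q)$, the three operators $$R^{\mathrm I}_Q=|A|^{-1/2}\sum_{a\in A}Q(a)\,X_a\otimes Z_a\in\mathrm{End}(V\otimes V),$$ $$R^{\mathrm{II}}_{Q,P}=\overline{\gamma(P)}\,|A|^{-1}\sum_{t,c\in A}Q(t)P(c)\,(X_tZ_c)\otimes(X_{-t}Z_c)\in\mathrm{End}(V\otimes V),$$ $$R^{\mathrm{III}}=|A|^{-1}\sum_{a,b\in A}q(a)^{-1}q(b)^{-1}\,\mathsf P_a\mathsf Q_{-b}\in\mathrm{End}(W\otimes W)$$ are unitary Yang--Baxter operators (the first two on $V$, the third on $W$).
   Context: $\mathrm U(1)$ denotes the complex numbers of modulus one. A finite metric abelian group $(A,q)$ is a finite abelian group $A$ (written additively) with a function $q:A\to\mathrm U(1)$ such that $q(-a)=q(a)$ and $\langle a,b\rangle:=\frac{q(a+b)}{q(a)q(b)}$ is a nondegenerate symmetric bicharacter on $A$. Put $\mathcal Q(q)=\{q\chi:\chi\in\mathrm{Hom}(A,\mathrm U(1))\}$, and for $F:A\to\mathrm U(1)$ put $\gamma(F)=|A|^{-1/2}\sum_{a\in A}F(a)$. $V=\mathbb C[A]$ is the Hilbert space with orthonormal basis $\{e_x:x\in A\}$, and $W=V\otimes V$. For $a\in A$, $X_ae_x=e_{x+a}$ and $Z_ae_x=\langle a,x\rangle e_x$. On $W\otimes W=(V\otimes V)\otimes(V\otimes V)$ put $\mathsf P_a=(I\otimes Z_a)\otimes(Z_a\otimes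 I)$ and $\mathsf Q_b=(X_b\otimes I)\otimes(X_b\otimes X_b)$. A unitary Yang--Baxter operator on a finite-dimensional Hilbert space $D$ is a unitary $R\in\mathrm{End}(D\otimes D)$ with $(R\otimes I)(I\otimes R)(R\otimes I)=(I\otimes R)(R\otimes I)(I\otimes R)$. *)

(* Defs.v *)
From HB Require Import structures.
From mathcomp Require Import all_boot all_order all_algebra.
From mathcomp Require Import mxtens complex.
From mathcomp Require Import reals.

Set Implicit Arguments.
Unset Strict Implicit.
Unset Printing Implicit Defensive.

Import Order.TTheory GRing.Theory Num.Theory.
Local Open Scope ring_scope.

Section MetricGroup.
Variables (C : numClosedFieldType) (A : finZmodType).
Implicit Types (q F Q chi : A -> C).

Definition bichar q (a b : A) : C := q (a + b) / (q a * q b).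

(* A U(1)-valued function on A is a function to C all of whose values have
   norm 1; since q is, bichar q is automatically U(1)-valued. *)
Record is_metric q : Prop := IsMetric {
  metric_norm : forall a, `|q a| = 1;
  metric_even : forall a, q (- a) = q a;
  metric_sym : forall a b, bichar q a b = bichar q b a;
  metric_addl : forall a b c,
    bichar q (a + b) c = bichar q a c * bichar q b c;
  metric_addr : forall a b c,
    bichar q a (b + c) = bichar q a b * bichar q a c;
  metric_nondeg : forall a, (forall b, bichar q a b = 1) -> a = 0
}.

Definition is_u1_hom chi : Prop :=
  (forall a, `|chi a| = 1) /\ (forall a b, chi (a + b) = chi a * chi b).

(* Membership in {q chi : chi in Hom(A, U(1))}. *)
Definition in_calQ q Q : Prop :=
  exists2 chi, is_u1_hom chi & forall a, Q a = q a * chi a.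

Definition card_isqrt : C := (sqrtC #|A|%:R)^-1.

Definition gauss_sum F : C := card_isqrt * \sum_(a : A) F a.

End MetricGroup.

Section Operators.
Variables (C : numClosedFieldType) (A : finZmodType) (q : A -> C).

(* The Hilbert space C[A] is the space of column vectors of height #|A|, with
   e x the coordinate vector at the rank of x in the enumeration of A.
   Operators are matrices acting on columns, so composition is *m, and tensor
   products of operators are Kronecker products. *)
Definition e (x : A) : 'cV[C]_#|A| := delta_mx (enum_rank x) 0.

Definition op_on_basis (f : A -> 'cV[C]_#|A|) : 'M[C]_#|A| :=
  \matrix_(i, j) f (enum_val j) i 0.

Lemma op_on_basisE f x : op_on_basis f *m e x = f x.
Proof.
apply/colP=> i; rewrite mxE (bigD1 (enum_rank x)) //= big1 => [|k nk].
  by rewrite !mxE !eqxx enum_rankK mulr1 addr0.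
by rewrite !mxE (negPf nk) mulr0.
Qed.

Definition opX (a : A) : 'M[C]_#|A| := op_on_basis (fun x => e (x + a)).

Definition opZ (a : A) : 'M[C]_#|A| :=
  op_on_basis (fun x => bichar q a x *: e x).

Definition opP (a : A) : 'M[C]_((#|A| * #|A|) * (#|A| * #|A|)) :=
  (1%:M *t opZ a) *t (opZ a *t 1%:M).

Definition opQ (b : A) : 'M[C]_((#|A| * #|A|) * (#|A| * #|A|)) :=
  (opX b *t 1%:M) *t (opX b *t opX b).

Definition R_I (Q : A -> C) : 'M[C]_(#|A| * #|A|) :=
  card_isqrt C A *: \sum_(a : A) Q a *: (opX a *t opZ a).

Definition R_II (Q P : A -> C) : 'M[C]_(#|A| * #|A|) :=
  ((gauss_sum P)^* / #|A|%:R) *: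
    \sum_(t : A) \sum_(c : A)
      (Q t * P c) *: ((opX t *m opZ c) *t (opX (- t) *m opZ c)).

Definition R_III : 'M[C]_((#|A| * #|A|) * (#|A| * #|A|)) :=
  #|A|%:R^-1 *:
    \sum_(a : A) \sum_(b : A)
      ((q a)^-1 * (q b)^-1) *: (opP a *m opQ (- b)).

End Operators.

Section YangBaxter.
Variables (C : numClosedFieldType) (d : nat).

Definition tens_idr (R : 'M[C]_(d * d)) : 'M[C]_(d * d * d) := R *t 1%:M.

Definition tens_idl (R : 'M[C]_(d * d)) : 'M[C]_(d * d * d) :=
  castmx (mulnA d d d, mulnA d d d) (1%:M *t R).

Definition is_unitary_YB (R : 'M[C]_(d * d)) : Prop :=
  R \is unitarymx /\
  tens_idr R *m tens_idl R *m tens_idr R =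
  tens_idl R *m tens_idr R *m tens_idl R.

End YangBaxter.

(* The cast in tens_idl is the canonical associator: Kronecker products are
   associative up to it. *)
Lemma tensmxA_cast (C : numClosedFieldType) (d : nat) (M N P : 'M[C]_d) :
  castmx (mulnA d d d, mulnA d d d) (M *t (N *t P)) = (M *t N) *t P.
Proof.
have unindex_cast (k : 'I_(d * d * d)) :
    let u := mxtens_unindex (cast_ord (esym (mulnA d d d)) k) in
    let v := mxtens_unindex k in
    u.1 = (mxtens_unindex v.1).1 /\
    mxtens_unindex u.2 = ((mxtens_unindex v.1).2, v.2).
  rewrite -[k]mxtens_unindexK; case: (mxtens_unindex k) => k12 k3.
  rewrite -[k12]mxtens_unindexK; case: (mxtens_unindex k12) => k1 k2.
  have Ek : cast_ord (esym (mulnA d d d))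
      (mxtens_index (mxtens_index (k1, k2), k3)) =
      mxtens_index (k1, mxtens_index (k2, k3)).
    by apply: val_inj; rewrite /= mulnDl addnA mulnA.
  rewrite Ek => u v.
  by rewrite /u /v !mxtens_indexK.
apply/matrixP=> i j; rewrite castmxE !mxE.
have [-> ->] := unindex_cast i; have [-> ->] := unindex_cast j.
by rewrite mulrA.
Qed.

(* Main.v *)
(* Each operator is a combination over g in G = A or A x A of tensor products
   of the Weyl operators X_x Z_c, which multiply as
   (X_x Z_c)(X_y Z_e) = <c,y> X_(x+y) Z_(c+e).  Both sides of the Yang-Baxter
   equation then expand over one family N(s,t) of tensor products of Weyl
   operators indexed by G x G; the coefficients are quadratic Gauss sums over G
   that agree after an affine change of the summation variable.  Unitarity
   reduces to the orthogonality of the characters <u,->. *)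

From HB Require Import structures.
Require Import Defs.
From mathcomp Require Import all_boot all_order all_algebra.
From mathcomp Require Import mxtens complex.
From mathcomp Require Import reals.
From mathcomp Require Import ring.

Import Order.TTheory GRing.Theory Num.Theory.
Local Open Scope ring_scope.

(* Gives A * A its finZmodType structure. *)
HB.saturate prod.

(** * Linear combinations of tensor products of matrices *)

Section MatrixCombinations.
Variables (C : numClosedFieldType) (G : finZmodType).
Implicit Types (F : G -> C) (k : C).
Local Open Scope sesquilinear_scope.

Lemma trmxC_tens (m n : nat) (M : 'M[C]_m) (N : 'M[C]_n) :
  (M *t N) ^t* = M ^t* *t N ^t*.
Proof. by rewrite trmx_tens map_mxT. Qed.

Lemma tensZl (m n : nat) (a : C) (M : 'M[C]_m) (N : 'M[C]_n) :
  (a *: M) *t N = a *: (M *t N).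
Proof. by apply/matrixP=> i j; rewrite !mxE mulrA. Qed.

Lemma tensZr (m n : nat) (a : C) (M : 'M[C]_m) (N : 'M[C]_n) :
  M *t (a *: N) = a *: (M *t N).
Proof. by apply/matrixP=> i j; rewrite !mxE mulrCA. Qed.

Lemma tens1mx1 (m n : nat) : (1%:M : 'M[C]_m) *t (1%:M : 'M_n) = 1%:M.
Proof.
apply/matrixP=> i j.
case: (mxtens_indexP i) => i1 i2; case: (mxtens_indexP j) => j1 j2.
rewrite tensmxE !mxE (can_eq (@mxtens_indexK m n)) xpair_eqE.
by case: eqP => //=; rewrite ?mul1r ?mul0r.
Qed.

Lemma tens_idr_comb (d : nat) k F (U : G -> 'M[C]_(d * d)) :
  tens_idr (k *: \sum_g F g *: U g) = k *: \sum_g F g *: tens_idr (U g).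
Proof.
apply/matrixP=> i j; rewrite !mxE !summxE -mulrA; congr (_ * _).
by rewrite mulr_suml; apply: eq_bigr => g _; rewrite !mxE mulrA.
Qed.

Lemma tens_idl_comb (d : nat) k F (U : G -> 'M[C]_(d * d)) :
  tens_idl (k *: \sum_g F g *: U g) = k *: \sum_g F g *: tens_idl (U g).
Proof.
apply/matrixP=> i j; rewrite castmxE !mxE !summxE mulrCA; congr (_ * _).
by rewrite mulr_sumr; apply: eq_bigr => g _; rewrite !mxE castmxE !mxE mulrCA.
Qed.

Lemma mul3_comb (n : nat) k F (U V : G -> 'M[C]_n) :
  (k *: \sum_g F g *: U g) *m (k *: \sum_g F g *: V g)
    *m (k *: \sum_g F g *: U g) =
  k ^+ 3 *: \sum_g \sum_h \sum_l (F g * F h * F l) *: (U g *m V h *m U l).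
Proof.
rewrite -!(scalemxAl, scalemxAr) !scalerA; congr (_ *: _).
rewrite !mulmx_suml; apply: eq_bigr => g _.
rewrite -mulmxA mulmx_suml mulmx_sumr; apply: eq_bigr => h _.
rewrite !mulmx_sumr; apply: eq_bigr => l _.
rewrite -!(scalemxAl, scalemxAr) !scalerA mulmxA.
by congr (_ *: _); ring.
Qed.

(* The sides of the equation collect to sums over s, t of N s t, the middle
   factor providing t on the left-hand side and s on the right-hand side. *)
Lemma yang_baxter_comb (d : nat) k F (U : G -> 'M[C]_(d * d))
    (N : G -> G -> 'M[C]_(d * d * d)) (th1 th2 : G -> G -> G -> C) :
    (forall g h l, tens_idr (U g) *m tens_idl (U h) *m tens_idr (U l) =
      th1 g h l *: N (g + l) h) ->
    (forall g h l, tens_idl (U g) *m tens_idr (U h) *m tens_idl (U l) =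
      th2 g h l *: N h (g + l)) ->
    (forall s t, F t * \sum_l F (s - l) * F l * th1 (s - l) t l =
      F s * \sum_l F (t - l) * F l * th2 (t - l) s l) ->
  let R := k *: \sum_g F g *: U g in
  tens_idr R *m tens_idl R *m tens_idr R =
  tens_idl R *m tens_idr R *m tens_idl R.
Proof.
move=> E1 E2 E12 R; rewrite /R tens_idr_comb tens_idl_comb !mul3_comb.
congr (_ *: _).
transitivity (\sum_s \sum_t
  (F t * \sum_l F (s - l) * F l * th1 (s - l) t l) *: N s t).
  under eq_bigr do rewrite exchange_big /=.
  rewrite exchange_big /=.
  (* The first index becomes s - l, so that g + l turns into s. *)
  under eq_bigr => l _ do rewrite (reindex_inj (addIr (- l))) /=.
  rewrite exchange_big /=; apply: eq_bigr => s _.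
  rewrite exchange_big /=; apply: eq_bigr => t _.
  rewrite mulr_sumr scaler_suml; apply: eq_bigr => l _.
  by rewrite E1 subrK scalerA; congr (_ *: _); ring.
under eq_bigr do under eq_bigr do rewrite E12.
under [RHS]eq_bigr do rewrite exchange_big /=.
rewrite [RHS]exchange_big /=.
under [RHS]eq_bigr => l _ do rewrite (reindex_inj (addIr (- l))) /=.
rewrite [RHS]exchange_big /= exchange_big /=; apply: eq_bigr => t _.
rewrite [RHS]exchange_big /=; apply: eq_bigr => s _.
rewrite mulr_sumr scaler_suml; apply: eq_bigr => l _.
by rewrite E2 subrK scalerA; congr (_ *: _); ring.
Qed.

(** Putting g = c + h in the double sum for R times its adjoint groups the terms by [U c], and the
    last hypothesis leaves only [U 0]. Here [lam] is the phase in the product of [U g] with the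
    adjoint of [U h]. *)
Lemma unitarymx_comb (n : nat) k F (U : G -> 'M[C]_n) (lam : G -> G -> C) :
    U 0 = 1%:M ->
    (forall g h, U g *m (U h) ^t* = lam g h *: U (g - h)) ->
    (forall c, k * k^* * (\sum_h F (c + h) * (F h)^* * lam (c + h) h) =
      (c == 0)%:R) ->
  k *: (\sum_g F g *: U g) \is unitarymx.
Proof.
move=> U0 UU H; apply/unitarymxP.
have -> : (k *: \sum_g F g *: U g) ^t* =
    k^* *: \sum_g (F g)^* *: (U g) ^t*.
  apply/matrixP=> i j; rewrite !mxE !summxE rmorphM rmorph_sum /=.
  by congr (_ * _); apply: eq_bigr => g _; rewrite !mxE rmorphM.
rewrite -scalemxAl -scalemxAr scalerA.
transitivity (\sum_c (k * k^* *
    (\sum_h F (c + h) * (F h)^* * lam (c + h) h)) *: U c).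
  rewrite mulmx_suml.
  under eq_bigr do rewrite mulmx_sumr.
  rewrite exchange_big /=.
  under eq_bigr => h _ do rewrite (reindex_inj (addIr h)) /=.
  rewrite exchange_big scaler_sumr /=; apply: eq_bigr => c _.
  rewrite mulr_sumr scaler_suml scaler_sumr; apply: eq_bigr => h _.
  by rewrite -scalemxAl -scalemxAr UU addrK !scalerA !mulrA.
rewrite (bigD1 0) //= H eqxx scale1r U0 big1 ?addr0 // => c c0.
by rewrite H (negPf c0) scale0r.
Qed.

End MatrixCombinations.

(** * Bicharacter identities and orthogonality of characters *)

Section MetricGroup.
Variables (C : numClosedFieldType) (A : finZmodType) (q : A -> C).
Hypothesis hq : is_metric q.
Local Notation b := (bichar q).

Lemma metric_neq0 x : q x != 0.
Proof. by rewrite -normr_eq0 (metric_norm hq) oner_eq0. Qed.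

Lemma bichar_norm x y : `|b x y| = 1.
Proof. by rewrite normf_div normrM !(metric_norm hq) mulr1 divr1. Qed.

Lemma bichar_neq0 x y : b x y != 0.
Proof. by rewrite -normr_eq0 bichar_norm oner_eq0. Qed.

Lemma metricD x y : q (x + y) = q x * q y * b x y.
Proof. by rewrite mulrC divfK // mulf_neq0 ?metric_neq0. Qed.

Lemma bichar0l x : b 0 x = 1.
Proof.
by apply: (mulfI (bichar_neq0 0 x)); rewrite -(metric_addl hq) addr0 mulr1.
Qed.

Lemma bichar0r x : b x 0 = 1.
Proof. by rewrite (metric_sym hq) bichar0l. Qed.

Lemma bicharNl x y : b (- x) y = (b x y)^-1.
Proof.
apply: (mulfI (bichar_neq0 x y)).
by rewrite -(metric_addl hq) subrr bichar0l divff ?bichar_neq0.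
Qed.

Lemma bicharNr x y : b x (- y) = (b x y)^-1.
Proof. by rewrite (metric_sym hq) bicharNl (metric_sym hq). Qed.

Lemma metric0 : q 0 = 1.
Proof.
have := bichar0l 0; rewrite /bichar addr0 invfM mulVKf ?metric_neq0 //.
by move=> /(congr1 GRing.inv); rewrite invrK invr1.
Qed.

(** Expanding 1 = q(x - x) with q even gives 1 = q(x)^2 / <x,x>. *)
Lemma bichar_diag x : b x x = q x ^+ 2.
Proof.
have := metricD x (- x); rewrite subrr metric0 (metric_even hq) bicharNr -expr2.
by move=> /(congr1 ( *%R^~ (b x x))); rewrite mul1r divfK ?bichar_neq0.
Qed.

Lemma conj_norm1 (z : C) : `|z| = 1 -> z^* = z^-1.
Proof. by move=> z1; rewrite invC_norm z1 expr1n invr1 mul1r. Qed.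

Lemma conj_bichar x y : (b x y)^* = (b x y)^-1.
Proof. exact/conj_norm1/bichar_norm. Qed.

(** For u nonzero, nondegeneracy gives y with <u,y> different from 1; translating x by y multiplies
    the sum by <u,y>, so it vanishes. *)
Lemma sum_bichar u : \sum_x b u x = #|A|%:R * (u == 0)%:R.
Proof.
have [->|u0] := eqVneq u 0.
  under eq_bigr do rewrite bichar0l.
  by rewrite sumr_const mulr1.
rewrite mulr0; have [y uy] : exists y, b u y != 1.
  apply/existsP; apply: contraNT u0; rewrite negb_exists => /forallP u1.
  by apply/eqP/(metric_nondeg hq) => y; apply/eqP; move: (u1 y); rewrite negbK.
have E : (b u y - 1) * \sum_x b u x = 0.
  rewrite mulrBl mul1r mulr_sumr [X in _ - X](reindex_inj (addrI y)) /=.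
  by under [X in _ - X]eq_bigr do rewrite (metric_addr hq); rewrite subrr.
by move/eqP: E; rewrite mulf_eq0 subr_eq0 (negPf uy) /= => /eqP.
Qed.

Lemma sum_bichar2 u v :
  \sum_(x : A * A) b u x.1 * b v x.2 = #|A|%:R ^+ 2 * ((u, v) == 0)%:R.
Proof.
rewrite -(pair_bigA _ (fun x y => b u x * b v y)) /=.
under eq_bigr do rewrite -mulr_sumr.
by rewrite -mulr_suml !sum_bichar mulrACA -expr2 -natrM mulnb.
Qed.

(** * Quadratic functions with the given bicharacter, and their Gauss sums *)

Record quadratic (F : A -> C) : Prop := Quadratic {
  quadratic_norm : forall x, `|F x| = 1;
  quadraticD : forall x y, F (x + y) = F x * F y * b x y
}.

Lemma calQ_quadratic F : in_calQ q F -> quadratic F.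
Proof.
move=> [chi [chi1 chiD] FE]; split=> [x|x y].
  by rewrite FE normrM (metric_norm hq) chi1 mulr1.
by rewrite !FE metricD chiD; ring.
Qed.

Lemma card_neq0 : #|A|%:R != 0 :> C.
Proof. by rewrite pnatr_eq0 -lt0n; apply/card_gt0P; exists 0. Qed.

Lemma card_isqrt_norm : card_isqrt C A * (card_isqrt C A)^* = #|A|%:R^-1.
Proof.
rewrite -normCK /card_isqrt normfV ger0_norm ?sqrtC_ge0 ?ler0n //.
by rewrite exprVn sqrtCK.
Qed.

Section Quadratic.
Variable F : A -> C.
Hypothesis hF : quadratic F.

Lemma quadratic_neq0 x : F x != 0.
Proof. by rewrite -normr_eq0 (quadratic_norm _ hF) oner_eq0. Qed.

Lemma conj_quadratic x : (F x)^* = (F x)^-1.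
Proof. exact/conj_norm1/(quadratic_norm _ hF). Qed.

Lemma quadratic0 : F 0 = 1.
Proof.
have := quadraticD _ hF 0 0; rewrite addr0 bichar0l mulr1.
by rewrite -[LHS]mulr1 => /(mulfI (quadratic_neq0 0)).
Qed.

(** Pulls F(x) out of the inner sums of the Yang-Baxter equation, leaving sums of bicharacter values
    only. *)
Lemma quadraticBM x y : F (x - y) * F y = F x * (b y y / b x y).
Proof.
have -> : b x y = b (x - y) y * b y y by rewrite -(metric_addl hq) subrK.
have -> : F x = F (x - y) * F y * b (x - y) y.
  by rewrite -(quadraticD _ hF) subrK.
by field; rewrite !bichar_neq0.
Qed.

Lemma quadratic_conj x y : F (x + y) * (F y)^* = F x * b x y.
Proof.
by rewrite (quadraticD _ hF) conj_quadratic; field; rewrite quadratic_neq0.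
Qed.

(** In the double sum put x = c + y: the summand becomes F(c)<c,y>, and summing over y removes every
    c except 0. *)
Lemma gauss_sum_norm : (gauss_sum F)^* * gauss_sum F = 1.
Proof.
rewrite /gauss_sum rmorphM rmorph_sum /= mulrACA [X in X * _]mulrC.
rewrite card_isqrt_norm [X in _ * X]mulrC big_distrlr exchange_big /=.
under eq_bigr => y _ do rewrite (reindex_inj (addIr y)) /=.
rewrite exchange_big /=.
under eq_bigr do under eq_bigr do rewrite quadratic_conj.
under eq_bigr do rewrite -mulr_sumr sum_bichar.
rewrite (bigD1 0) //= big1 => [|c c0]; last by rewrite (negPf c0) !mulr0.
by rewrite eqxx quadratic0 addr0 mul1r mulr1 mulVf ?card_neq0.
Qed.

End Quadratic.

(** * Weyl operators *)

Section Weyl.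
Local Open Scope sesquilinear_scope.

Definition weyl (x c : A) : 'M[C]_#|A| := opX C x *m opZ q c.

Lemma weylE x c i j :
  weyl x c i j = b c (enum_val j) * (enum_val i == enum_val j + x)%:R.
Proof.
rewrite mxE (bigD1 j) //= big1 => [|k kj]; last first.
  by rewrite !mxE enum_valK (negPf kj) !mulr0.
rewrite addr0 !mxE enum_valK !eqxx mulr1 mulrC andbT; congr (_ * _%:R).
by rewrite -(inj_eq enum_val_inj) enum_rankK.
Qed.

Lemma mul_weyl x c y e :
  weyl x c *m weyl y e = b c y *: weyl (x + y) (c + e).
Proof.
apply/matrixP=> i j; rewrite [RHS]mxE weylE mxE.
rewrite (bigD1 (enum_rank (enum_val j + y))) //=.
rewrite big1 => [|k kj]; last first.
  rewrite !weylE -[k]enum_valK.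
  case: (_ =P enum_val j + y) => [/(congr1 enum_rank)|]; last by rewrite !mulr0.
  by rewrite !enum_rankK enum_valK => /eqP; rewrite (negPf kj).
rewrite !weylE enum_rankK eqxx !(metric_addr hq) (metric_addl hq) addrAC addrA.
by rewrite mulr1 addr0; ring.
Qed.

(** The adjoint is Z_(-c) X_(-x); reordering it costs <-c,-x> = <c,x>. *)
Lemma trmxC_weyl x c : (weyl x c) ^t* = b c x *: weyl (- x) (- c).
Proof.
apply/matrixP=> i j; rewrite [RHS]mxE 2!mxE !weylE rmorphM rmorph_nat /=.
have -> : (enum_val i == enum_val j - x) = (enum_val j == enum_val i + x).
  by rewrite eq_sym subr_eq.
case: eqP => [->|]; last by rewrite !mulr0.
rewrite conj_bichar bicharNl (metric_addr hq).
by field; rewrite !bichar_neq0.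
Qed.

Lemma weyl00 : weyl 0 0 = 1%:M.
Proof.
apply/matrixP=> i j; rewrite weylE bichar0l mul1r addr0 mxE.
by rewrite (inj_eq enum_val_inj).
Qed.

Lemma opX_weyl x : opX C x = weyl x 0.
Proof.
rewrite /weyl; suff -> : opZ q 0 = 1%:M by rewrite mulmx1.
by apply/matrixP=> i j; rewrite !mxE bichar0l mul1r enum_valK andbT.
Qed.

Lemma opZ_weyl c : opZ q c = weyl 0 c.
Proof.
rewrite /weyl; suff -> : opX C (0 : A) = 1%:M by rewrite mul1mx.
by apply/matrixP=> i j; rewrite !mxE addr0 enum_valK andbT.
Qed.

End Weyl.

(** * Unitarity and the Yang-Baxter equation for the three operators *)

Lemma tens_idl_tens (d : nat) (M N : 'M[C]_d) :
  tens_idl (M *t N) = 1%:M *t M *t N.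
Proof. exact: tensmxA_cast. Qed.

Definition tensor_weylE :=
  (trmxC_tens, tensmx_mul, trmxC_weyl, mul_weyl, tensZl, tensZr,
   scalerA, bichar0l, bichar0r, addr0, add0r, mulr1, mul1r, scale1r, oppr0).

Lemma R_I_unitary_YB F : quadratic F -> is_unitary_YB (R_I q F).
Proof.
move=> hF; split.
  (* No phase: each slot contains only shifts or only multiplications. *)
  apply: (@unitarymx_comb _ _ _ _ _ _ (fun _ _ => 1)).
  - by rewrite opX_weyl opZ_weyl weyl00 tens1mx1.
  - move=> g h; rewrite !opX_weyl !opZ_weyl.
    by rewrite !(trmxC_tens, trmxC_weyl, tensmx_mul) -!scalemxAr !tensor_weylE.
  - move=> c; under eq_bigr do rewrite (quadratic_conj _ hF) mulr1.
    rewrite -mulr_sumr sum_bichar card_isqrt_norm.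
    have [->|_] := eqVneq c 0; last by rewrite !mulr0.
    by rewrite (quadratic0 _ hF) mul1r mulr1 mulVf ?card_neq0.
(* Only the middle slot gives a phase: Z_g passes X_h on the left-hand side, Z_h passes X_l on the
   right-hand side. *)
apply: (@yang_baxter_comb _ _ _ _ _ _
  (fun s t => weyl s 0 *t weyl t s *t weyl 0 t)
  (fun g h l => b g h) (fun g h l => b h l)).
- move=> g h l; rewrite !tens_idl_tens /tens_idr -!weyl00 !opX_weyl !opZ_weyl.
  by rewrite !tensmx_mul !mul_weyl -?scalemxAl !tensor_weylE.
- move=> g h l; rewrite !tens_idl_tens /tens_idr -!weyl00 !opX_weyl !opZ_weyl.
  by rewrite !tensmx_mul !mul_weyl -?scalemxAl !tensor_weylE.
move=> s t.
under eq_bigr do rewrite (quadraticBM _ hF) -mulrA.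
under [X in _ = F s * X]eq_bigr do rewrite (quadraticBM _ hF) -mulrA.
rewrite -!mulr_sumr mulrCA; congr (_ * (_ * _)).
rewrite [RHS](reindex_inj (can_inj (subKr t))) /=; apply: eq_bigr => l _.
rewrite !(metric_addl hq) !(metric_addr hq) !bicharNl !bicharNr.
rewrite !(metric_sym hq l).
by field; rewrite !bichar_neq0.
Qed.

Lemma R_II_comb F P :
  R_II q F P = ((gauss_sum P)^* / #|A|%:R) *:
    \sum_(g : A * A) (F g.1 * P g.2) *: (weyl g.1 g.2 *t weyl (- g.1) g.2).
Proof. by rewrite /R_II pair_bigA. Qed.

Lemma R_II_unitary_YB F P :
  quadratic F -> quadratic P -> is_unitary_YB (R_II q F P).
Proof.
move=> hF hP; rewrite R_II_comb; split.
  (* The opposite shifts in the two slots produce inverse phases, which cancel. *)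
  apply: (@unitarymx_comb _ _ _ _ _ _ (fun _ _ => 1)).
  - by rewrite /= oppr0 weyl00 tens1mx1.
  - move=> g h; rewrite !(trmxC_tens, trmxC_weyl, tensmx_mul) -!scalemxAr.
    rewrite !tensor_weylE !opprK.
    rewrite -[RHS]scale1r.
    congr (_ *: (_ *t weyl _ _)); last by rewrite opprB addrC.
    by rewrite !bicharNr; field; rewrite !bichar_neq0.
  - move=> c.
    under eq_bigr => h _ do rewrite mulr1 rmorphM /= mulrACA
      !(quadratic_conj _ hF, quadratic_conj _ hP) mulrACA.
    rewrite -mulr_sumr sum_bichar2.
    (* As the Gauss sum has modulus 1, the prefactor has squared modulus |A|^(-2), which offsets the
       character sum over A x A. *)
    rewrite (rmorphM _ (gauss_sum P)^*) /= conjCK fmorphV rmorph_nat.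
    rewrite [X in X * _]mulrACA (gauss_sum_norm _ hP) -surjective_pairing.
    have [->|_] := eqVneq c 0; last by rewrite !mulr0.
    by rewrite !quadratic0 //; field; rewrite card_neq0.
apply: (@yang_baxter_comb _ _ _ _ _ _
  (fun s t => weyl s.1 s.2 *t weyl (t.1 - s.1) (s.2 + t.2) *t weyl (- t.1) t.2)
  (fun g h l => b g.2 h.1 / b h.2 l.1) (fun g h l => b h.2 l.1 / b g.2 h.1)).
- move=> g h l; rewrite !tens_idl_tens /tens_idr -!weyl00.
  rewrite !tensmx_mul !mul_weyl -?scalemxAl !tensor_weylE.
  congr (_ *: (_ *t weyl _ _ *t _)).
  + by rewrite !bicharNr !(metric_addl hq); field; rewrite !bichar_neq0.
  + by rewrite opprD addrCA addrA.
  + by rewrite addrAC.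
- move=> g h l; rewrite !tens_idl_tens /tens_idr -!weyl00.
  rewrite !tensmx_mul !mul_weyl -?scalemxAl !tensor_weylE.
  congr (_ *: (_ *t weyl _ _ *t weyl _ _)).
  + by rewrite !bicharNr !(metric_addl hq); field; rewrite !bichar_neq0.
  + by rewrite addrAC.
  + by rewrite addrCA addrA.
  + by rewrite opprD.
move=> s t.
under eq_bigr do
  rewrite /= [X in X * _]mulrACA (quadraticBM _ hF) (quadraticBM _ hP).
under [X in _ = _ * X]eq_bigr do
  rewrite /= [X in X * _]mulrACA (quadraticBM _ hF) (quadraticBM _ hP).
(* Both summands have quadratic part <l1,l1><l2,l2>, which is invariant under (l1,l2) -> (-l2,l1);
   the shifts t2 and s2 make the linear parts agree. *)
pose r (l : A * A) := (t.2 - l.2, s.2 + l.1).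
pose r' (l : A * A) := (l.2 - s.2, t.2 - l.1).
have rK : cancel r r'.
  by move=> [x y]; rewrite /r /r' /= addrC addKr subKr.
rewrite !mulr_sumr (reindex_inj (can_inj rK)); apply: eq_bigr => l _ /=.
rewrite !(metric_addl hq, metric_addr hq, bicharNl, bicharNr).
rewrite !(metric_sym hq l.1 (_ _)) !(metric_sym hq l.2 (_ _)).
rewrite ?(metric_sym hq t.2 s.1).
by field; rewrite !bichar_neq0.
Qed.

(* Slot 3 contributes <a,-b> on reordering P_a Q_(-b), which merges
   q(a)^-1 q(b)^-1 into q(a+b)^-1. *)
Lemma R_III_comb :
  R_III q = #|A|%:R^-1 *:
    \sum_(g : A * A) (q (g.1 + g.2))^-1 *:
      ((weyl (- g.2) 0 *t weyl 0 g.1) *t (weyl (- g.2) g.1 *t weyl (- g.2) 0)).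
Proof.
rewrite /R_III pair_bigA; congr (_ *: _); apply: eq_bigr => g _ /=.
rewrite /opP /opQ !opX_weyl !opZ_weyl -!weyl00 !tensmx_mul !mul_weyl.
rewrite !tensor_weylE; congr (_ *: _).
by rewrite metricD bicharNr; field; rewrite bichar_neq0 !metric_neq0.
Qed.

Lemma R_III_unitary_YB : is_unitary_YB (R_III q).
Proof.
rewrite R_III_comb; split.
  (* The phase comes from the third slot, the only one mixing shifts and multiplications. *)
  apply: (@unitarymx_comb _ _ _ _ _ _ (fun g h => b g.1 h.2 / b h.1 h.2)).
  - by rewrite /= oppr0 weyl00 !tens1mx1.
  - move=> g h; rewrite !(trmxC_tens, trmxC_weyl, tensmx_mul) -!scalemxAr.
    rewrite !tensor_weylE !opprK !opprD !opprK; congr (_ *: _).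
    by rewrite !bicharNr; field; rewrite !bichar_neq0.
  - move=> c.
    (* The phase <c1,h2> cancels part of <c1+c2,h1+h2>^(-1), so the summand separates into
       characters of h1 and h2; orthogonality then forces c1 + c2 = 0 and c2 = 0. *)
    transitivity (#|A|%:R ^- 2 * \sum_(h : A * A) (q (c.1 + c.2))^-1 *
        (b (- (c.1 + c.2)) h.1 * b (- c.2) h.2)).
      rewrite fmorphV rmorph_nat -expr2 exprVn; congr (_ * _).
      apply: eq_bigr => h _ /=.
      rewrite fmorphV /= conj_norm1 ?(metric_norm hq) // invrK.
      rewrite addrACA (metricD (c.1 + c.2)) !bicharNl.
      rewrite !(metric_addl hq) !(metric_addr hq).
      by field; rewrite !bichar_neq0 !metric_neq0.
    rewrite -mulr_sumr sum_bichar2.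
    have -> : ((- (c.1 + c.2), - c.2) == 0) = (c == 0).
      case: c => x y; rewrite !xpair_eqE /= !oppr_eq0.
      by case: (y =P 0) => [->|_]; rewrite ?addr0 ?andbF.
    have [->|_] := eqVneq c 0; last by rewrite !mulr0.
    by rewrite /= addr0 metric0; field; rewrite card_neq0.
apply: (@yang_baxter_comb _ _ _ _ _ _
  (fun s t => weyl (- s.2) 0 *t weyl 0 s.1
    *t (weyl (- s.2 - t.2) s.1 *t weyl (- s.2) t.1)
    *t (weyl (- t.2) t.1 *t weyl (- t.2) 0))
  (fun g h l => (b g.1 h.2 * b g.1 l.2 * b h.1 l.2)^-1)
  (fun g h l => (b h.1 l.2 * b g.1 h.2 * b g.1 l.2)^-1)).
- move=> g h l; rewrite !tens_idl_tens /tens_idr -!tens1mx1 -!weyl00.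
  rewrite !tensmx_mul !mul_weyl -?scalemxAl !tensor_weylE.
  rewrite !opprD.
  congr (_ *: (_ *t (weyl _ _ *t _) *t _)).
  + by rewrite !bicharNr; field; rewrite !bichar_neq0.
  + by rewrite addrAC.
- move=> g h l; rewrite !tens_idl_tens /tens_idr -!tens1mx1 -!weyl00.
  rewrite !tensmx_mul !mul_weyl -?scalemxAl !tensor_weylE.
  rewrite !opprD.
  congr (_ *: (_ *t (weyl _ _ *t _) *t _)).
  + by rewrite !bicharNr; field; rewrite !bichar_neq0.
  + by rewrite addrCA addrA.
move=> s t.
(* Both summands have quadratic part the inverse of <l1,l1><l2,l2><l1,l2>, symmetric in l1 and l2;
   exchanging and negating them with shifts t2 and s2 matches the linear parts. *)
pose r (l : A * A) := (t.2 - l.2, s.2 - l.1).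
pose r' (l : A * A) := (s.2 - l.2, t.2 - l.1).
have rK : cancel r r' by move=> [x y]; rewrite /r /r' /= !subKr.
rewrite !mulr_sumr (reindex_inj (can_inj rK)); apply: eq_bigr => l _ /=.
(* Expanding [q] and using <x,x> = q(x)^2 leaves a rational identity in values of [q] and the
   bicharacter at single variables. *)
rewrite !(metric_even hq, metricD).
rewrite !(metric_addl hq, metric_addr hq, bicharNl, bicharNr) !bichar_diag.
rewrite !(metric_sym hq l.1 (_ _)) !(metric_sym hq l.2 (_ _)).
by field; rewrite !bichar_neq0 !metric_neq0.
Qed.

End MetricGroup.

Theorem theorem4p8 (R : realType) (A : finZmodType) (q : A -> R[i])
    (hq : is_metric q) (Q P : A -> R[i])
    (hQ : in_calQ q Q) (hP : in_calQ q P) :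
  [/\ is_unitary_YB (R_I q Q),
      is_unitary_YB (R_II q Q P)
    & is_unitary_YB (R_III q)].
Proof.
have [hF hG] := (calQ_quadratic _ _ _ hq _ hQ, calQ_quadratic _ _ _ hq _ hP).
by split;
  [apply: R_I_unitary_YB | apply: R_II_unitary_YB | apply: R_III_unitary_YB].
Qed.
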